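(* Let $K$ be a field and $A$ a finite-dimensional $K$-algebra. Every left finite wide subcategory of $\operatorname{mod}A$ is functorially finite in $\operatorname{mod}A$; that is, $\operatorname{f_L-wide}A\subset\operatorname{f-wide}A$.
   Context: $\operatorname{mod} A$ is the category of finite-dimensional right $A$-modules. A wide subcategory is a full subcategory of $\operatorname{mod}A$ closed under kernels, cokernels and extensions. $\operatorname{f-wide}A$ is the set of wide subcategories that are functorially finite in $\operatorname{mod}A$. A torsion class is a full subcategory of $\operatorname{mod}A$ closed under extensions and factor modules. $\operatorname{f_L-wide}A$ is the set of left finite wide subcategories, i.e. wide subcategories $\mathcal W$ such that the smallest torsion class containing $\mathcal W$ is functorially finite in $\operatorname{mod}A$. *)

(* Defs.v *)
From HB Require Import structures.
From mathcomp Require Import all_boot all_order all_algebra all_field.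

Set Implicit Arguments.
Unset Strict Implicit.
Unset Printing Implicit Defensive.

Import GRing.Theory.
Local Open Scope ring_scope.

Record rmodule (K : fieldType) (A : falgType K) := RModule {
  rmod_space :> vectType K;
  ract : rmod_space -> A -> rmod_space;
  ract_linearl : forall a (k : K) (x y : rmod_space),
    ract (k *: x + y) a = k *: ract x a + ract y a;
  ract_linearr : forall x (k : K) (a b : A),
    ract x (k *: a + b) = k *: ract x a + ract x b;
  ract1 : forall x, ract x 1 = x;
  ractM : forall x (a b : A), ract x (a * b) = ract (ract x a) b
}.

Record rhom (K : fieldType) (A : falgType K) (M N : rmodule A) := RHom {
  rhom_lfun :> 'Hom(M, N);
  rhomP : forall (x : M) (a : A), rhom_lfun (ract x a) = ract (rhom_lfun x) a
}.

(* [i] is a kernel of [f], resp. [p] is a cokernel of [f]; in [mod A] this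
   determines the object up to isomorphism, so a class of modules closed under
   kernels, or under cokernels, and containing 0 is closed under isomorphism. *)
Definition is_kernel (K : fieldType) (A : falgType K) (L M N : rmodule A)
    (i : rhom L M) (f : rhom M N) : Prop :=
  lker i = 0%VS /\ limg i = lker f.

Definition is_cokernel (K : fieldType) (A : falgType K) (M N Q : rmodule A)
    (f : rhom M N) (p : rhom N Q) : Prop :=
  limg p = fullv /\ lker p = limg f.

Definition short_exact (K : fieldType) (A : falgType K) (L M N : rmodule A)
    (i : rhom L M) (p : rhom M N) : Prop :=
  [/\ lker i = 0%VS, limg i = lker p & limg p = fullv].

(* A full subcategory is given by its class of objects. *)
Definition subcat (K : fieldType) (A : falgType K) := rmodule A -> Prop.

Section Subcategories.
Variables (K : fieldType) (A : falgType K).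
Implicit Types C T W : subcat A.

(* Subcategories are additive: wide subcategories and torsion classes are
   required to contain the zero modules, which excludes the empty class. *)
Definition contains_zero C : Prop :=
  forall M : rmodule A, (forall x : M, x = 0) -> C M.

Definition closed_kernels C : Prop :=
  forall (L M N : rmodule A) (i : rhom L M) (f : rhom M N),
    is_kernel i f -> C M -> C N -> C L.

Definition closed_cokernels C : Prop :=
  forall (M N Q : rmodule A) (f : rhom M N) (p : rhom N Q),
    is_cokernel f p -> C M -> C N -> C Q.

Definition closed_extensions C : Prop :=
  forall (L M N : rmodule A) (i : rhom L M) (p : rhom M N),
    short_exact i p -> C L -> C N -> C M.

Definition closed_factors C : Prop :=
  forall (M N : rmodule A) (p : rhom M N), limg p = fullv -> C M -> C N.

Definition wide W : Prop :=
  [/\ contains_zero W, closed_kernels W, closed_cokernels W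
    & closed_extensions W].

Definition torsion_class T : Prop :=
  [/\ contains_zero T, closed_extensions T & closed_factors T].

Definition torsion_closure W : subcat A :=
  fun X => forall T, torsion_class T -> (forall M, W M -> T M) -> T X.

Definition right_approx C (M X : rmodule A) (f : rhom M X) : Prop :=
  C M /\ forall (N : rmodule A) (g : rhom N X), C N ->
    exists h : rhom N M, g = (f \o h)%VF :> 'Hom(N, X).

Definition left_approx C (X M : rmodule A) (f : rhom X M) : Prop :=
  C M /\ forall (N : rmodule A) (g : rhom X N), C N ->
    exists h : rhom M N, g = (h \o f)%VF :> 'Hom(X, N).

Definition contravariantly_finite C : Prop :=
  forall X : rmodule A, exists (M : rmodule A) (f : rhom M X), right_approx C f.

Definition covariantly_finite C : Prop :=
  forall X : rmodule A, exists (M : rmodule A) (f : rhom X M), left_approx C f.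

Definition functorially_finite C : Prop :=
  contravariantly_finite C /\ covariantly_finite C.

Definition f_wide W : Prop := wide W /\ functorially_finite W.

Definition fL_wide W : Prop :=
  wide W /\ functorially_finite (torsion_closure W).

Lemma torsion_closure_torsion W : torsion_class (torsion_closure W).
Proof.
split=> [M M0 T tT _|L M N i p ex cL cN T tT sWT|M N p sp cM T tT sWT].
- by case: tT => T0 _ _; apply: T0.
- by case: (tT) => _ Te _; apply: Te ex (cL T tT sWT) (cN T tT sWT).
- by case: (tT) => _ _ Tf; apply: Tf sp (cM T tT sWT).
Qed.

End Subcategories.

(* Main.v *)
(* The modules M such that every map from M to an object of W has its image in
   W form a torsion class containing W, hence containing T(W).  So an object M of
   T(W) has a largest quotient in W, and composing a left T(W)-approximation
   X -> M with this quotient map gives a left W-approximation of X.  In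
   particular W has a generator P, a left approximation of A.  For the right
   approximations, take the map e : Q -> X from a sum Q of copies of P through
   which all maps P -> X factor, and divide Q by the trace of P in ker e. *)

Require Import Defs.
From HB Require Import structures.
From mathcomp Require Import all_boot all_order all_algebra all_field.
From Stdlib Require Import Classical.

Set Implicit Arguments.
Unset Strict Implicit.
Unset Printing Implicit Defensive.

Import GRing.Theory.
Local Open Scope ring_scope.

(** * Maximal bounded numbers and finite spanning families *)

Lemma max_of_bounded (P : nat -> Prop) (b : nat) :
  (exists n, P n) -> (forall n, P n -> (n <= b)%N) ->
  exists2 n, P n & forall m, P m -> (m <= n)%N.
Proof.
move=> [n0 Pn0] Pb; apply: NNPP => noMax.
(* Without a maximum, [P] would hold at arbitrarily large numbers, in particular above [b]. *)
suff above k : exists2 n, P n & (k <= n)%N.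
  by have [n /Pb leb ltb] := above b.+1; move: (leq_trans ltb leb); rewrite ltnn.
elim: k => [|k [n Pn lekn]]; first by exists n0.
apply: NNPP => noS; apply: noMax; exists n => // m Pm; rewrite leqNgt.
by apply/negP => ltnm; apply: noS; exists m => //; apply: leq_ltn_trans ltnm.
Qed.

(** Take a sequence in [P] whose span has maximal dimension: adjoining a further element of [P]
    cannot enlarge the span. *)
Lemma spanning_seq (K : fieldType) (V : vectType K) (P : V -> Prop) :
  exists2 s : seq V, forall x, x \in s -> P x & forall x, P x -> x \in <<s>>%VS.
Proof.
pose D n := exists2 s : seq V, forall x, x \in s -> P x & \dim <<s>> = n.
have [||n [s sP ds] nmax] := @max_of_bounded D (\dim {:V}).
- by exists (\dim <<[::] : seq V>>), [::].
- by move=> n [s _ <-]; apply/dimvS/subvf.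
exists s => // x Px.
have /nmax : D (\dim <<x :: s>>).
  by exists (x :: s) => // y /[1!inE] /orP[/eqP->//|/sP].
rewrite -ds => le_dim; rewrite memvE.
have sub : (<<s>> <= <<x :: s>>)%VS by rewrite span_cons addvSr.
have /eqP -> : (<<s>> == <<x :: s>>)%VS by rewrite eqEdim sub.
by rewrite span_cons addvSl.
Qed.

(** * Homomorphisms, submodules and quotient modules *)

Section Modules.
Variables (K : fieldType) (A : falgType K).
Implicit Types (M N L X Q : rmodule A).

Lemma ractDl M (x y : M) a : ract (x + y) a = ract x a + ract y a.
Proof. by have := ract_linearl a 1 x y; rewrite !scale1r. Qed.

Lemma ract0l M a : ract (0 : M) a = 0.
Proof. by apply: (addrI (ract 0 a)); rewrite -ractDl !addr0. Qed.

Lemma rhom_build M N (f : M -> N) :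
  linear f -> (forall x a, f (ract x a) = ract (f x) a) ->
  exists g : rhom M N, forall x, g x = f x.
Proof.
move=> lf fA.
pose F : {linear M -> N} := HB.pack f (GRing.isLinear.Build K M N *:%R f lf).
have FE x : linfun F x = f x by rewrite lfunE.
have FA x a : linfun F (ract x a) = ract (linfun F x) a by rewrite !FE fA.
by exists (RHom FA).
Qed.

Lemma rcomp_subproof L M N (g : rhom M N) (f : rhom L M) x a :
  (g \o f)%VF (ract x a) = ract ((g \o f)%VF x) a.
Proof. by rewrite !comp_lfunE !rhomP. Qed.

Definition rcomp L M N (g : rhom M N) (f : rhom L M) : rhom L N :=
  RHom (rcomp_subproof g f).

Lemma rcompE L M N (g : rhom M N) (f : rhom L M) x : rcomp g f x = g (f x).
Proof. exact: comp_lfunE. Qed.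

Lemma rhom_surjP M N (f : rhom M N) :
  limg f = fullv <-> forall y, exists x, f x = y.
Proof.
split=> [fs y|fs].
  have /memv_imgP[x _ ->] : y \in limg f by rewrite fs memvf.
  by exists x.
apply/eqP; rewrite eqEsubv subvf; apply/subvP => y _.
by have [x <-] := fs y; rewrite memv_img ?memvf.
Qed.

Lemma rhom_injP M N (f : rhom M N) :
  lker f = 0%VS <-> forall x, f x = 0 -> x = 0.
Proof.
split=> [f0 x fx|fI]; first by apply/eqP; rewrite -memv0 -f0 memv_ker fx.
apply/eqP; rewrite -subv0; apply/subvP => x; rewrite memv_ker memv0.
by move=> /eqP/fI->.
Qed.

Lemma mem_rimg M N (f : rhom M N) x : f x \in limg f.
Proof. by rewrite memv_img ?memvf. Qed.

Lemma rimgP M N (f : rhom M N) y : y \in limg f -> exists x, f x = y.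
Proof. by move=> /memv_imgP[x _ ->]; exists x. Qed.

Definition stable M (U : {vspace M}) := forall x (a : A), x \in U -> ract x a \in U.

Lemma stable_lker M N (f : rhom M N) : stable (lker f).
Proof.
move=> x a; rewrite !memv_ker rhomP => /eqP ->.
by rewrite ract0l.
Qed.

Lemma stable_limg M N (f : rhom M N) : stable (limg f).
Proof. by move=> _ a /memv_imgP[x _ ->]; rewrite -rhomP mem_rimg. Qed.

Lemma stable0 M : stable (0%VS : {vspace M}).
Proof.
move=> x a; rewrite memv0 => /eqP ->.
by rewrite ract0l memv0.
Qed.

Lemma submodule_exists M (U : {vspace M}) : stable U ->
  exists L, exists i : rhom L M, lker i = 0%VS /\ limg i = U.
Proof.
move=> sU.
pose act (x : subvs_of U) (a : A) : subvs_of U := vsproj U (ract (vsval x) a).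
have actE x a : vsval (act x a) = ract (vsval x) a.
  by rewrite vsprojK //; apply: sU; apply: subvsP.
have l1 a (k : K) x y : act (k *: x + y) a = k *: act x a + act y a.
  by apply: subvs_inj; rewrite [RHS]vsval_is_linear !actE vsval_is_linear ract_linearl.
have l2 x (k : K) a b : act x (k *: a + b) = k *: act x a + act x b.
  by apply: subvs_inj; rewrite [RHS]vsval_is_linear !actE ract_linearr.
have l3 x : act x 1 = x by apply: subvs_inj; rewrite actE ract1.
have l4 x a b : act x (a * b) = act (act x a) b.
  by apply: subvs_inj; rewrite !actE ractM.
pose L := RModule l1 l2 l3 l4.
have [i iE] := @rhom_build L M vsval (linearP vsval) actE.
exists L, i; split.
  by apply/rhom_injP => x; rewrite iE => x0; apply: subvs_inj; rewrite x0 linear0.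
apply/eqP; rewrite eqEsubv; apply/andP; split; apply/subvP => x.
  by move=> /rimgP[y <-]; rewrite iE subvsP.
by move=> xU; rewrite -(vsprojK xU) -iE mem_rimg.
Qed.

(** The quotient lives on a linear complement of [U], the image of [1 - projv U]. The complement
    need not be stable, so the action of [M] is followed by the projection back onto it. *)
Lemma quotient_exists M (U : {vspace M}) : stable U ->
  exists Q, exists q : rhom M Q, limg q = fullv /\ lker q = U.
Proof.
move=> sU; pose e : 'End(M) := (\1 - projv U)%VF.
have eE x : e x = x - projv U x by rewrite add_lfunE opp_lfunE id_lfunE.
pose q (x : M) : subvs_of (limg e) := vsproj (limg e) (e x).
have qE x : vsval (q x) = x - projv U x by rewrite -eE; apply/vsprojK/memv_img/memvf.
have ql : linear q by move=> k x y; rewrite /q !linearP.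
have qK y : q (vsval y) = y.
  apply: subvs_inj; rewrite qE.
  have /memv_imgP[x _ ->] := subvsP y.
  by rewrite eE linearB /= (projv_id (memv_proj U x)) subrr subr0.
have q0 x : (q x == 0) = (x \in U).
  apply/eqP/idP => [/(congr1 vsval)|xU]; last first.
    by apply: subvs_inj; rewrite qE projv_id // subrr linear0.
  by rewrite qE linear0 => /eqP; rewrite subr_eq0 => /eqP ->; apply: memv_proj.
have qD x y : q (x + y) = q x + q y by have := ql 1 x y; rewrite !scale1r.
have qA x a : q (ract x a) = q (ract (vsval (q x)) a).
  have {1}-> : x = vsval (q x) + projv U x by rewrite qE subrK.
  rewrite ractDl qD.
  have /eqP-> : q (ract (projv U x) a) == 0 by rewrite q0 sU // memv_proj.
  by rewrite addr0.
pose act (y : subvs_of (limg e)) (a : A) := q (ract (vsval y) a).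
have l1 a (k : K) x y : act (k *: x + y) a = k *: act x a + act y a.
  by rewrite /act linearP ract_linearl ql.
have l2 x (k : K) a b : act x (k *: a + b) = k *: act x a + act x b.
  by rewrite /act ract_linearr ql.
have l3 x : act x 1 = x by rewrite /act ract1 qK.
have l4 x a b : act x (a * b) = act (act x a) b.
  by rewrite /act ractM qA.
pose Q := RModule l1 l2 l3 l4.
have [p pE] := @rhom_build M Q q ql qA.
exists Q, p; split.
  by apply/rhom_surjP => y; exists (vsval y); rewrite pE qK.
by apply/vspaceP => x; rewrite memv_ker pE q0.
Qed.

(** The factor is [f] after a [K]-linear section of [q]. As [f] is constant on the fibres of [q],
    the section need not respect the action of [A]. *)
Lemma factor_epi M Q N (q : rhom M Q) (f : rhom M N) :
  limg q = fullv -> (lker q <= lker f)%VS ->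
  exists g : rhom Q N, forall x, f x = g (q x).
Proof.
move=> /rhom_surjP qs /subvP kqf.
have fq x y : q x = q y -> f x = f y.
  move=> qxy; apply/eqP; rewrite -subr_eq0 -linearB -memv_ker kqf //.
  by rewrite memv_ker linearB /= qxy subrr.
have qK y : q ((q^-1)%VF y) = y.
  by apply: limg_lfunVK; have [x <-] := qs y; apply: mem_rimg.
have [|y a|g gE] := @rhom_build Q N (fun y => f ((q^-1)%VF y)).
- by move=> k x y; rewrite !linearP.
- by rewrite -rhomP; apply: fq; rewrite rhomP !qK.
by exists g => x; rewrite gE; apply: fq; rewrite qK.
Qed.

Lemma factor_mono L M N (i : rhom L M) (f : rhom N M) :
  lker i = 0%VS -> (limg f <= limg i)%VS ->
  exists g : rhom N L, forall x, f x = i (g x).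
Proof.
move=> i0 /subvP fi.
have iI : injective i by apply/lker0P; rewrite i0.
have iK x : i ((i^-1)%VF (f x)) = f x by apply/limg_lfunVK/fi/mem_rimg.
have [|y a|g gE] := @rhom_build N L (fun y => (i^-1)%VF (f y)).
- by move=> k x y; rewrite !linearP.
- by apply: iI; rewrite iK !rhomP iK.
by exists g => x; rewrite gE iK.
Qed.

(** * Direct sums, the regular module and the zero module *)

Section DirectSum.
Variables M N : rmodule A.
Let V : vectType K := (M * N)%type.
Let act (x : V) (a : A) : V := (ract x.1 a, ract x.2 a).

Fact dsum_linearl a (k : K) x y : act (k *: x + y) a = k *: act x a + act y a.
Proof. by rewrite /act !ract_linearl. Qed.

Fact dsum_linearr x (k : K) a b : act x (k *: a + b) = k *: act x a + act x b.
Proof. by rewrite /act !ract_linearr. Qed.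

Fact dsum_act1 x : act x 1 = x.
Proof. by rewrite /act !ract1; case: x. Qed.

Fact dsum_actM x (a b : A) : act x (a * b) = act (act x a) b.
Proof. by rewrite /act !ractM. Qed.

Definition dsum : rmodule A :=
  RModule dsum_linearl dsum_linearr dsum_act1 dsum_actM.
End DirectSum.

Lemma pairing X M N (f : rhom X M) (g : rhom X N) :
  exists h : rhom X (dsum M N), forall x, h x = (f x, g x).
Proof.
apply: rhom_build => [k x y|x a]; first by rewrite !linearP.
by rewrite !rhomP.
Qed.

Lemma copairing X M N (f : rhom M X) (g : rhom N X) :
  exists h : rhom (dsum M N) X, forall x, h x = f x.1 + g x.2.
Proof.
apply: (@rhom_build (dsum M N)) => [k x y|x a].
  by rewrite !linearP scalerDr addrACA.
by rewrite ractDl !rhomP.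
Qed.

Lemma id_rhom M : exists h : rhom M M, forall x, h x = x.
Proof. by apply: rhom_build. Qed.

Lemma zero_rhom M N : exists h : rhom M N, forall x, h x = 0.
Proof.
by apply: rhom_build => [k x y|x a]; rewrite ?scaler0 ?addr0 ?ract0l.
Qed.

Definition regular : rmodule A :=
  @RModule K A A (fun x a => x * a)
    (fun a k x y => etrans (mulrDl _ _ _) (congr1 (+%R^~ _) (esym (scalerAl _ _ _))))
    (fun x k a b => etrans (mulrDr _ _ _) (congr1 (+%R^~ _) (esym (scalerAr _ _ _))))
    (@mulr1 A) (@mulrA A).

Lemma regular_to M (x : M) : exists h : rhom regular M, forall a, h a = ract x a.
Proof.
by apply: (@rhom_build regular) => [k a b|a b]; rewrite ?ract_linearr ?ractM.
Qed.

Lemma scale_rhom M (k : K) : exists h : rhom M M, forall x, h x = k *: x.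
Proof.
have ractZ (x : M) a : ract (k *: x) a = k *: ract x a.
  by have := ract_linearl a k x 0; rewrite ract0l !addr0.
apply: rhom_build => [l x y|x a]; last by rewrite ractZ.
by rewrite scalerDr !scalerA mulrC.
Qed.

Lemma zero_module : exists Z : rmodule A, forall x : Z, x = 0.
Proof.
have [Z [i [/rhom_injP iI i0]]] := submodule_exists (@stable0 regular).
by exists Z => x; apply: iI; apply/eqP; rewrite -memv0 -i0 mem_rimg.
Qed.

(** * Images in a wide subcategory, and left approximations *)

Variable W : subcat A.

Section Wide.
Hypothesis wW : wide W.

(** The image of [f] is the kernel of the cokernel of [f]. *)
Lemma wide_image M N I (f : rhom M N) (i : rhom I N) :
  W M -> W N -> lker i = 0%VS -> limg i = limg f -> W I.
Proof.
case: wW => _ Wk Wc _ WM WN i0 iE.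
have [Q [c [cs ck]]] := quotient_exists (stable_limg (f := f)).
have WQ : W Q by apply: (Wc _ _ _ f c).
by apply: (Wk _ _ _ i c) => //; split=> //; rewrite ck.
Qed.

Lemma wide_dsum M N : W M -> W N -> W (dsum M N).
Proof.
case: wW => _ _ _ We WM WN.
have [z zE] := zero_rhom M N; have [z' z'E] := zero_rhom N M.
have [u uE] := id_rhom M; have [v vE] := id_rhom N.
have [i iE] := pairing u z; have [p pE] := copairing z v.
apply: (We _ _ _ i p) => //; split.
- by apply/rhom_injP => x; rewrite iE uE => -[].
- apply/vspaceP => -[x y]; rewrite memv_ker pE zE vE add0r /=.
  apply/idP/eqP => [/(@rimgP _ _ i)[w]|->]; first by rewrite iE zE => -[].
  by have := mem_rimg i x; rewrite iE uE zE.
- by apply/rhom_surjP => y; exists (0, y); rewrite pE zE vE add0r.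
Qed.

(** A subspace [limg f] is not itself an [rmodule], so the image is represented by any module [I]
    embedded onto it. *)
Definition images_in : subcat A := fun M =>
  forall N I (f : rhom M N) (i : rhom I N),
    W N -> lker i = 0%VS -> limg i = limg f -> W I.

(* If [L] is a submodule of [M], then [f M] is an extension of [f M / f L], the
   image of [M / L] in [N / f L], by [f L]. *)
Lemma images_in_extensions : closed_extensions images_in.
Proof.
case: (wW) => _ _ Wc We L M N a b [a0 ab bs] imL imN Y I f i WY i0 iE.
have [J [j [j0 jE]]] := submodule_exists (stable_limg (f := rcomp f a)).
have WJ : W J by apply: imL WY j0 jE.
have [Q [c [cs ck]]] := quotient_exists (stable_limg (f := j)).
have WQ : W Q by apply: (Wc _ _ _ j c).
have cf0 : (lker b <= lker (rcomp c f))%VS.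
  rewrite -ab; apply/subvP => _ /rimgP[x <-].
  by rewrite memv_ker rcompE -memv_ker ck jE -rcompE mem_rimg.
have [g gE] := factor_epi bs cf0.
have [J' [j' [j'0 j'E]]] := submodule_exists (stable_limg (f := g)).
have WJ' : W J' by apply: imN WQ j'0 j'E.
have ji : (limg j <= limg i)%VS.
  by rewrite jE iE; apply/subvP => _ /rimgP[x <-]; rewrite rcompE mem_rimg.
have [k kE] := factor_mono i0 ji.
have cif (y : I) : exists x, c (i y) = g (b x).
  have /rimgP[x fx] : i y \in limg f by rewrite -iE mem_rimg.
  by exists x; rewrite -gE rcompE fx.
have cij' : (limg (rcomp c i) <= limg j')%VS.
  rewrite j'E; apply/subvP => _ /rimgP[y <-]; rewrite rcompE.
  by have [x ->] := cif y; rewrite mem_rimg.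
have [r rE] := factor_mono j'0 cij'.
have j'I : injective j' by apply/lker0P; rewrite j'0.
have iI : injective i by apply/lker0P; rewrite i0.
(* Here [J] is the image of [L] in [Y], and [J'] is the image of [N] in [Q], the quotient of [Y] by
   [J]. The sequence from [J] through [I] to [J'] is exact. *)
apply: (We _ _ _ k r) WJ WJ'; split.
- apply/rhom_injP => x kx; apply: (proj1 (rhom_injP j) j0).
  by rewrite kE kx linear0.
- apply/vspaceP => y; rewrite memv_ker -(inj_eq j'I) linear0 -rE rcompE.
  rewrite -memv_ker ck; apply/idP/idP => [/rimgP[x <-]|/rimgP[x jx]].
    by rewrite -kE mem_rimg.
  by rewrite (_ : y = k x) ?mem_rimg //; apply: iI; rewrite -kE.
- apply/rhom_surjP => y.
  have /rimgP[z gz] : j' y \in limg g by rewrite -j'E mem_rimg.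
  have [x bx] := proj1 (rhom_surjP b) bs z.
  have /rimgP[w iw] : f x \in limg i by rewrite iE mem_rimg.
  exists w; apply: j'I.
  by rewrite -rE rcompE iw -gz -bx -gE rcompE.
Qed.

Lemma images_in_torsion : torsion_class images_in.
Proof.
split; last 2 first.
- exact: images_in_extensions.
- move=> M N p /rhom_surjP ps imM Y I f i WY i0 iE.
  apply: (imM Y I (rcomp f p) i) => //; rewrite iE.
  apply/vspaceP => y; apply/idP/idP => /rimgP[x <-].
    by have [z <-] := ps x; rewrite -rcompE mem_rimg.
  by rewrite rcompE mem_rimg.
move=> M M0 Y I f i WY i0 iE; case: wW => W0 _ _ _; apply: W0 => x.
apply: (proj1 (rhom_injP i) i0).
have /rimgP[m <-] : i x \in limg f by rewrite -iE mem_rimg.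
by rewrite (M0 m) linear0.
Qed.

(** [torsion_closure W] lies in every torsion class containing [W], and [images_in] is one by
    [images_in_torsion] and [wide_image]. *)
Lemma torsion_closure_images M : torsion_closure W M -> images_in M.
Proof.
apply=> [|N WN Y I f i]; [exact: images_in_torsion | exact: wide_image].
Qed.

(* The kernels of the maps from [M] to [W] are closed under intersection, so
   there is a smallest one, and [M] modulo it is the reflection of [M] in [W]. *)
Lemma images_in_left_approx M : images_in M ->
  exists N (f : rhom M N), left_approx W f.
Proof.
move=> imM; have [W0 _ _ _] := wW.
(* By rank-nullity, a map of maximal rank has a kernel of minimal dimension. *)
pose D n := exists N (f : rhom M N), W N /\ \dim (limg f) = n.
have dimE N (f : rhom M N) : (\dim (lker f) + \dim (limg f) = \dim {:M})%N.
  by rewrite -(limg_ker_dim f fullv) capfv.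
have [||_ [N [f [WN <-]]] fmax] := @max_of_bounded D (\dim {:M}).
- have [Z Z0] := zero_module; have [z _] := zero_rhom M Z.
  by exists (\dim (limg z)), Z, z; split=> //; apply: W0.
- by move=> n [N [f [_ <-]]]; rewrite -(dimE _ f) leq_addl.
(* The kernel of the pairing of [f] and [g] is the intersection of their kernels; maximality makes
   it all of [lker f]. *)
have kf N' (g : rhom M N') : W N' -> (lker f <= lker g)%VS.
  move=> WN'; have [h hE] := pairing f g.
  have hf : (lker h <= lker f)%VS.
    by apply/subvP => x; rewrite !memv_ker hE => /eqP[->].
  have /fmax le_dim : D (\dim (limg h)).
    by exists (dsum N N'), h; split=> //; apply: wide_dsum.
  have /eqP <- : (lker h == lker f)%VS.
    rewrite eqEdim hf -(leq_add2r (\dim (limg f))) dimE -(dimE _ h).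
    by rewrite leq_add2l.
  by apply/subvP => x; rewrite !memv_ker hE => /eqP[_ ->].
(* Restricting the target to the image makes the map surjective, so that maps factor through it by
   comparing kernels. *)
have [I [i [i0 iE]]] := submodule_exists (stable_limg (f := f)).
have fi : (limg f <= limg i)%VS by rewrite iE.
have [q qE] := factor_mono i0 fi.
have WI : W I by apply: imM WN i0 iE.
have qs : limg q = fullv.
  have iI : injective i by apply/lker0P; rewrite i0.
  apply/rhom_surjP => y.
  have /rimgP[x fx] : i y \in limg f by rewrite -iE mem_rimg.
  by exists x; apply: iI; rewrite -qE.
exists I, q; split=> // N' g WN'.
have qg : (lker q <= lker g)%VS.
  apply: subv_trans (kf _ g WN'); apply/subvP => x.
  by rewrite !memv_ker qE => /eqP ->; rewrite linear0.
have [h hE] := factor_epi qs qg.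
by exists h; apply/lfunP => x; rewrite comp_lfunE -hE.
Qed.

Lemma wide_covariantly_finite :
  covariantly_finite (torsion_closure W) -> covariantly_finite W.
Proof.
move=> cf X; have [T [t [/torsion_closure_images imT tP]]] := cf X.
have [M [f [WM fP]]] := images_in_left_approx imT.
exists M, (rcomp f t); split=> // N g WN.
have [|h gE] := tP N g; first by move=> T' _; apply.
by have [k hE] := fP N h WN; exists k; rewrite gE hE -comp_lfunA.
Qed.

(** * Right approximations from a generator *)

Definition lifts P Q X (e : rhom Q X) :=
  forall g : rhom P X, exists h : rhom P Q, forall x, g x = e (h x).

(* [Q] is a finite direct sum of copies of [P]; the last clause records the only
   consequence of this that is needed. *)
Lemma universal_map P X : W P ->
  exists Q (e : rhom Q X), [/\ W Q, lifts P e &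
    forall Y Z (e' : rhom Y Z), lifts P e' -> lifts Q e'].
Proof.
move=> WP.
have [s sP sS] := spanning_seq (fun u : 'Hom(P, X) => exists g : rhom P X, u = g).
(* Lifting is asked for on the span of [s], which allows induction on [s] with one copy of [P] per
   element. *)
suff [Q [e [WQ eP Ql]]] : exists Q (e : rhom Q X), [/\ W Q,
    forall u, u \in <<s>>%VS -> exists h : rhom P Q, forall x, u x = e (h x)
    & forall Y Z (e' : rhom Y Z), lifts P e' -> lifts Q e'].
  by exists Q, e; split=> // g; apply/eP/sS; exists g.
elim: s sP {sS} => [_|v s IH sP].
  have [Z Z0] := zero_module; have [e eE] := zero_rhom Z X.
  exists Z, e; split=> [|u|Y Y' e' _ g].
  - by case: wW => W0 _ _ _; apply: W0.
  - rewrite span_nil memv0 => /eqP ->; have [h _] := zero_rhom P Z.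
    by exists h => x; rewrite eE lfunE.
  - have [h hE] := zero_rhom Z Y; exists h => x.
    by rewrite hE (Z0 x) !linear0.
have [|Q [e [WQ eP Ql]]] := IH; first by move=> u us; apply: sP; rewrite inE us orbT.
have [g vE] := sP v (mem_head _ _).
have [e' e'E] := copairing g e.
exists (dsum P Q), e'; split; first exact: wide_dsum.
  move=> u; rewrite span_cons => /memv_addP[_ /vlineP[k ->] [w /eP[h hE] ->]].
  have [m mE] := scale_rhom P k; have [h' h'E] := pairing m h.
  exists h' => x; rewrite h'E e'E mE /= linearZ /=.
  by rewrite add_lfunE scale_lfunE hE vE.
move=> Y Z e1 Pe1 d.
have [z zE] := zero_rhom P Q; have [z' z'E] := zero_rhom Q P.
have [u uE] := id_rhom P; have [t tE] := id_rhom Q.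
have [i iE] := pairing u z; have [j jE] := pairing z' t.
(* The restrictions of [d] to the two summands are lifted separately and then added. *)
have [a aE] := Pe1 (rcomp d i); have [b bE] := Ql _ _ _ Pe1 (rcomp d j).
have [c cE] := copairing a b; exists c => x.
rewrite cE linearD /= -aE -bE !rcompE -linearD iE jE uE zE z'E tE.
by congr (d _); case: x => x y; congr pair; rewrite ?addr0 ?add0r.
Qed.

(* Let [e : Q -> X] be universal among maps from sums of copies of a generator
   [P] of [W].  Dividing [Q] by the image of all maps from [P] to [ker e] gives
   the approximation: a map [N -> X] with [N] in [W] lifts to [Q] on generators
   of [N], and the relations of [N], again generated by [P], go to [ker e]. *)
Lemma wide_contravariantly_finite :
  covariantly_finite W -> contravariantly_finite W.
Proof.
move=> cf X; have [_ Wk Wc _] := wW.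
have [P [p [WP pP]]] := cf regular.
(* Each [y] in [N] is the image of [1] under a map from [regular]. This map factors through [p], and
   the resulting map from [P] lifts to [Q]. *)
have gen N Q (e : rhom Q N) : W N -> lifts P e -> limg e = fullv.
  move=> WN Pe; apply/rhom_surjP => y.
  have [r rE] := regular_to y; have [h hE] := pP N r WN.
  have [k kE] := Pe h; exists (k (p 1)); rewrite -kE.
  by rewrite -[h _]comp_lfunE -hE rE ract1.
have [Q [e [WQ Pe Ql]]] := universal_map X WP.
have [Ke [ke [ke0 keE]]] := submodule_exists (stable_lker (f := e)).
have [Q' [e' [WQ' Pe' _]]] := universal_map Ke WP.
have [C [c [cs ck]]] := quotient_exists (stable_limg (f := rcomp ke e')).
have WC : W C by apply: (Wc _ _ _ (rcomp ke e') c).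
have ce : (lker c <= lker e)%VS.
  rewrite ck -keE; apply/subvP => _ /rimgP[x <-].
  by rewrite rcompE mem_rimg.
have [f fE] := factor_epi cs ce.
exists C, f; split=> // N g WN.
have [QN [pi [WQN Ppi QNl]]] := universal_map N WP.
have pis := gen _ _ _ WN Ppi.
have [h hE] := QNl _ _ _ Pe (rcomp g pi).
have [L [l [l0 lE]]] := submodule_exists (stable_lker (f := pi)).
have WL : W L by apply: (Wk _ _ _ l pi).
have [QL [rho [_ Prho QLl]]] := universal_map L WP.
have /rhom_surjP rhos := gen _ _ _ WL Prho.
have pich : (lker pi <= lker (rcomp c h))%VS.
  have hk : (limg (rcomp h (rcomp l rho)) <= limg ke)%VS.
    rewrite keE; apply/subvP => _ /rimgP[x <-].
    rewrite memv_ker !rcompE -hE rcompE.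
    have : l (rho x) \in lker pi by rewrite -lE mem_rimg.
    by rewrite memv_ker => /eqP ->; rewrite linear0.
  have [m mE] := factor_mono ke0 hk.
  (* Lifting [m] through [e'] puts the relations of [N] into the image of [rcomp ke e'], which [c]
     kills. *)
  have [n nE] := QLl _ _ _ Pe' m.
  rewrite -lE; apply/subvP => _ /rimgP[y <-]; have [x <-] := rhos y.
  rewrite memv_ker rcompE -memv_ker ck.
  by have := mE x; rewrite !rcompE => ->; rewrite nE -rcompE mem_rimg.
have [g' g'E] := factor_epi pis pich.
exists g'; apply/lfunP => y; rewrite comp_lfunE.
have [x <-] := proj1 (rhom_surjP pi) pis y.
by rewrite -g'E rcompE -fE -hE rcompE.
Qed.

End Wide.
End Modules.

Theorem proposition1p28 (K : fieldType) (A : falgType K) (W : subcat A) :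
  fL_wide W -> f_wide W.
Proof.
case=> wW [_ cfT]; have cfW := wide_covariantly_finite wW cfT.
by split=> //; split=> //; apply: wide_contravariantly_finite.
Qed.
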